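(* Let $\mathbf H \in \{\mathbf Z, \mathbf N\}$. Given $\alpha\in[0,1]$, there exists a set $A\subseteq\mathbf H$ with $0\in A$ and $\gcd(A)=1$ such that $2A=\mathbf H$, $A\in\mathrm{dom}(\mu)$, and $\mu(A)=\alpha$ for every quasi-density $\mu$ on $\mathbf H$.
   Context: $\mathbf N=\{0,1,2,\dots\}$, $\mathbf N^+=\{1,2,\dots\}$. $2A:=\{a+b: a,b\in A\}$. For $X \subseteq \mathbf Z$ and $k,h\in\mathbf Z$, $k\cdot X+h:=\{kx+h : x\in X\}$. An upper quasi-density on $\mathbf H$ is a function $\mu^\ast:\mathcal P(\mathbf H)\to\mathbf R$ such that for all $X,Y\subseteq\mathbf H$: (1) $\mu^\ast(X)\le\mu^\ast(\mathbf H)=1$; (2) $\mu^\ast(X\cup Y)\le\mu^\ast(X)+\mu^\ast(Y)$; (3) $\mu^\ast(k\cdot X+h)=\frac1k\mu^\ast(X)$ for all $k\in\mathbf N^+$, $h\in\mathbf H$ (monotonicity is not required). Its conjugate is $\mu_\ast(X):=1-\mu^\ast(\mathbf H\setminus X)$. The quasi-density induced by $\mu^\ast$ is the restriction $\mu$ of $\mu^\ast$ to $\mathrm{dom}(\mu):=\{X\subseteq\mathbf H:\mu^\ast(X)=\mu_\ast(X)\}$; a quasi-density on $\mathbf H$ is any function arising this way. *)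

(* Defs.v *)
From mathcomp Require Import all_boot all_order all_algebra.
From mathcomp Require Import boolp classical_sets reals.

Set Implicit Arguments.
Unset Strict Implicit.
Unset Printing Implicit Defensive.

Import Order.TTheory GRing.Theory Num.Theory.
Local Open Scope classical_set_scope.
Local Open Scope ring_scope.

Definition ZZ : set int := [set: int].
Definition NN : set int := [set x | 0 <= x].

Definition dilate_shift (k : int) (X : set int) (h : int) : set int :=
  [set k * x + h | x in X].

Definition double_set (A : set int) : set int :=
  [set a + b | a in A & b in A].

Definition set_gcd (A : set int) (d : nat) : Prop :=
  (forall a, A a -> (d %| a)%Z) /\
  (forall e : nat, (forall a, A a -> (e %| a)%Z) -> (e %| d)%N).

(* Functions on the power set of H are represented by functions on [set int]
   of which only the values at subsets of H are ever constrained or used. *)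
Record upper_quasi_density (R : realType) (H : set int) (mus : set int -> R) :
    Prop := UpperQuasiDensity {
  uqd_total : mus H = 1 ;
  uqd_le_total : forall X, X `<=` H -> mus X <= mus H ;
  uqd_subadditive : forall X Y, X `<=` H -> Y `<=` H ->
    mus (X `|` Y) <= mus X + mus Y ;
  uqd_dilate_shift : forall X (k h : int), X `<=` H -> 0 < k -> H h ->
    mus (dilate_shift k X h) = k%:~R^-1 * mus X
}.

Definition conjugate (R : realType) (H : set int) (mus : set int -> R)
    (X : set int) : R :=
  1 - mus (H `\` X).

(* A quasi-density is a partial function, given by its domain [dom] together
   with a function [mu] whose values outside [dom] are irrelevant. *)
Definition induced_by (R : realType) (H : set int) (mus : set int -> R)
    (dom : set (set int)) (mu : set int -> R) : Prop :=
  dom = [set X | X `<=` H /\ mus X = conjugate H mus X] /\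
  (forall X, dom X -> mu X = mus X).

Definition quasi_density (R : realType) (H : set int)
    (dom : set (set int)) (mu : set int -> R) : Prop :=
  exists2 mus : set int -> R,
    upper_quasi_density H mus & induced_by H mus dom mu.

(* Main.v *)
(* Without monotonicity, one controls an upper quasi-density on all subsets of
   a set at once: the bound "[mus Y <= r] for every [Y] contained in [X]" is
   stable under unions and affine images.  The integers with base-4 digits in
   {0,1} form a set E with E contained in (4E) u (4E+1), so this bound can be
   halved indefinitely on E, while E + 2E = N: hence (adjoining -E and -2E when
   H = Z) there is a basis B of order 2 all of whose subsets have upper
   quasi-density 0.  If b_0 b_1 b_2 ... is a binary expansion of alpha, let C be
   the set of 2^i (2y+1) with y in H and b_i = 1.  Peeling off one digit at a
   time bounds C by alpha, and, via the complementary digits, H \ (C u {0}) by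
   1 - alpha.  Then A = B u C works, since 0 is in B. *)
Require Import Defs.
From mathcomp Require Import all_boot all_order all_algebra.
From mathcomp Require Import boolp classical_sets reals.
From mathcomp Require Import zify ring lra.

Set Implicit Arguments.
Unset Strict Implicit.
Unset Printing Implicit Defensive.

Import Order.TTheory GRing.Theory Num.Theory.
Local Open Scope classical_set_scope.
Local Open Scope ring_scope.

(** * Geometric limits and digit sets *)

Lemma ler_addgt0_halves (R : realType) (x y : R) :
  (forall n, x <= y + 2^-1 ^+ n) -> x <= y.
Proof.
move=> le_xy; rewrite leNgt; apply/negP => lt_yx.
have xy_gt0 : 0 < x - y by rewrite subr_gt0.
have := archi_boundP (ltW (eqbRL (invr_gt0 _) xy_gt0)).
set n := Num.bound _ => lt_n.
have lt_n2 : (n%:R : R) < 2 ^+ n by rewrite -natrX ltr_nat ltn_expl.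
have := le_xy n; rewrite exprVn leNgt => /negP; apply.
rewrite -ltrBrDl -(invrK (x - y)) ltf_pV2 ?posrE ?exprn_gt0 ?invr_gt0 //.
exact: lt_trans lt_n lt_n2.
Qed.

(** The parameter [s] lets one proof serve both E ([s = 1]) and -E ([s = -1]). *)
Inductive digits01 (s : int) : set int :=
| Digits01_nil : digits01 s 0
| Digits01_0 x : digits01 s x -> digits01 s (4 * x)
| Digits01_1 x : digits01 s x -> digits01 s (4 * x + s).

(** Each base-4 digit is e + 2f with e, f in {0,1}, so the digits of [n] split independently,
    without carries. *)
Lemma digits01_decomp (s : int) (n : nat) :
  exists2 a, digits01 s a & exists2 b, digits01 s b & s * n%:Z = a + 2 * b.
Proof.
have step (e : nat) x : (e < 2)%N -> digits01 s x ->
    digits01 s (4 * x + s * e%:Z).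
  case: e => [|[|//]] _ dx.
    by rewrite mulr0 addr0; exact: Digits01_0.
  by rewrite mulr1; exact: Digits01_1.
elim/ltn_ind: n => -[_|n IHn].
  by exists 0; [exact: Digits01_nil|exists 0; [exact: Digits01_nil|lia]].
set m := n.+1 in IHn *; have lt_m : (m %/ 4 < m)%N by lia.
have [a da [b db abE]] := IHn _ lt_m.
exists (4 * a + s * ((m %% 4) %% 2)%N%:Z); first by apply: step => //; lia.
exists (4 * b + s * ((m %% 4) %/ 2)%N%:Z); first by apply: step => //; lia.
have mE : m%:Z = 4 * (m %/ 4)%N%:Z + ((m %% 4) %% 2)%N%:Z
                 + 2 * ((m %% 4) %/ 2)%N%:Z by lia.
rewrite mE; have -> : 4 * a = 4 * (s * (m %/ 4)%N%:Z) - 8 * b.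
  by rewrite abE; ring.
ring.
Qed.

(* The integers [2 ^ i * (2 * y + 1)] with [H y] and [b i]. *)
Inductive odd_part_class (H : set int) (b : nat -> bool) : set int :=
| OddPart_odd y : b 0%N -> H y -> odd_part_class H b (2 * y + 1)
| OddPart_even x : odd_part_class H (fun i => b i.+1) x ->
    odd_part_class H b (2 * x).

(** * Closure properties of the ambient set *)

Section Ambient.
Variables (H : set int) (H_ZN : H = ZZ \/ H = NN).

Lemma ambient_nonneg (x : int) : 0 <= x -> H x.
Proof. by case: H_ZN => ->. Qed.

Lemma ambientD (x y : int) : H x -> H y -> H (x + y).
Proof. by case: H_ZN => -> //; rewrite /NN /=; lia. Qed.

Lemma ambientMn (k x : int) : 0 <= k -> H x -> H (k * x).
Proof. by case: H_ZN => -> //; rewrite /NN /=; nia. Qed.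

Lemma digits01_sub (s : int) : H s -> digits01 s `<=` H.
Proof.
move=> Hs x; elim=> [|y _ Hy|y _ Hy]; first exact: ambient_nonneg.
  exact: ambientMn.
by apply: ambientD => //; exact: ambientMn.
Qed.

Lemma odd_part_class_sub (b : nat -> bool) : odd_part_class H b `<=` H.
Proof.
move=> x; elim=> {b x} [b y _ Hy|b x _ Hx]; last exact: ambientMn.
by apply: ambientD; [exact: ambientMn|exact: ambient_nonneg].
Qed.

Lemma odd_part_class_or_negb (b : nat -> bool) (x : int) : H x -> x != 0 ->
  odd_part_class H b x \/ odd_part_class H (fun i => ~~ b i) x.
Proof.
(* Halving a nonzero even [x] decreases its absolute value and shifts [b], which commutes with
   negating [b]; an odd [x] is settled by [b 0]. *)
move: {2}`|x|%N (leqnn `|x|%N) => n; elim: n b x => [|n IHn] b x le_xn Hx x0.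
  lia.
have [[y xE]|[y xE]] : (exists y, x = 2 * y) \/ (exists y, x = 2 * y + 1).
- have := divz_eq x 2; have := modz_ge0 x (isT : (2 : int) != 0).
  have := ltz_pmod x (isT : (0 : int) < 2).
  move=> lt2 ge0 xE.
  have [r0|r1] : (x %% 2)%Z = 0 \/ (x %% 2)%Z = 1 by lia.
    by left; exists (x %/ 2)%Z; lia.
  by right; exists (x %/ 2)%Z; lia.
- have Hy : H y.
    by move: Hx; rewrite xE; case: H_ZN => -> //; rewrite /NN /=; lia.
  have [] := IHn (fun i => b i.+1) y _ Hy; [lia|lia| |] => Cy; rewrite xE.
    by left; apply: OddPart_even.
  by right; apply: OddPart_even.
have Hy : H y.
  by move: Hx; rewrite xE; case: H_ZN => -> //; rewrite /NN /=; lia.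
rewrite xE; case b0: (b 0%N); [left|right]; apply: OddPart_odd => //.
by rewrite b0.
Qed.

(** * Bounds holding for all subsets of a set *)

Section UpperBounds.
Variables (R : realType) (mus : set int -> R).
Hypothesis mus_uqd : upper_quasi_density H mus.

Definition subsets_le (X : set int) (r : R) : Prop :=
  forall Y, Y `<=` H -> Y `<=` X -> mus Y <= r.

Lemma subsets_le_mono (X X' : set int) (r r' : R) :
  X `<=` X' -> r' <= r -> subsets_le X' r' -> subsets_le X r.
Proof.
move=> sXX' le_r leX' Y YH YX; apply: le_trans le_r.
by apply: leX' => //; exact: subset_trans sXX'.
Qed.

Lemma subsets_le1 (X : set int) : subsets_le X 1.
Proof. by move=> Y YH _; rewrite -(uqd_total mus_uqd); exact: uqd_le_total. Qed.

Lemma subsets_leU (X X' : set int) (r r' : R) :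
  subsets_le X r -> subsets_le X' r' -> subsets_le (X `|` X') (r + r').
Proof.
move=> leX leX' Y YH YX.
have -> : Y = (Y `&` X) `|` (Y `&` X').
  by rewrite -setIUr; apply/esym/setIidPl.
have subH Z : Y `&` Z `<=` H by move=> z [/YH].
apply: (le_trans (uqd_subadditive mus_uqd (subH X) (subH X'))).
by apply: lerD; [apply: leX|apply: leX'] => // z [].
Qed.

Lemma subsets_le_dilate_shift (X : set int) (k h : int) (r : R) :
  X `<=` H -> 0 < k -> H h -> subsets_le X r ->
  subsets_le (dilate_shift k X h) (k%:~R^-1 * r).
Proof.
move=> XH k_gt0 Hh leX Y YH YX.
(* Pulling [Y] back along the affine map makes [Y] itself a full affine image, to which the scaling
   axiom applies. *)
pose Y' := [set x | X x /\ Y (k * x + h)].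
have Y'H : Y' `<=` H by move=> x [/XH].
have -> : Y = dilate_shift k Y' h.
  apply/seteqP; split=> [y Yy|y [x [_ Yx] <-//]].
  by have [x Xx xE] := YX y Yy; exists x => //; split=> //; rewrite xE.
rewrite (uqd_dilate_shift mus_uqd) // ler_pM2l ?invr_gt0 ?ltr0z //.
by apply: leX => // x [].
Qed.

Lemma subsets_le_digits01 (s : int) : H s -> subsets_le (digits01 s) 0.
Proof.
move=> Hs; have EH := digits01_sub Hs.
have H0 : H 0 by exact: ambient_nonneg.
have le_halves n : subsets_le (digits01 s) (2^-1 ^+ n).
  elim: n => [|n IHn]; first by rewrite expr0; exact: subsets_le1.
  apply: subsets_le_mono (subsets_leU
    (subsets_le_dilate_shift EH (isT : (0 : int) < 4) H0 IHn)
    (subsets_le_dilate_shift EH (isT : (0 : int) < 4) Hs IHn)).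
    move=> x; case=> [|y Ey|y Ey].
    - by left; exists 0; [exact: Digits01_nil|].
    - by left; exists y => //; rewrite addr0.
    - by right; exists y.
  by rewrite exprS; lra.
move=> Y YH YE; apply: ler_addgt0_halves => n; rewrite add0r.
exact: le_halves.
Qed.

(* [a k] is the real number whose binary digits are [b k, b k.+1, ...]. *)
Lemma subsets_le_odd_part_class (b : nat -> bool) (a : nat -> R) :
  (forall n, 0 <= a n) -> (forall n, 2 * a n = (b n)%:R + a n.+1) ->
  subsets_le (odd_part_class H b) (a 0%N).
Proof.
move=> a_ge0 aE.
have H0 : H 0 by exact: ambient_nonneg.
have H1 : H 1 by exact: ambient_nonneg.
have CH b' : odd_part_class H b' `<=` H by exact: odd_part_class_sub.
(* After n digits the remaining tail is bounded only by 1, which costs at most 2^-n. The induction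
   varies [b] and [a], since it passes to the tail. *)
suff le_halves n : subsets_le (odd_part_class H b) (a 0%N + 2^-1 ^+ n).
  by move=> Y YH YC; apply: ler_addgt0_halves => n; exact: le_halves.
elim: n b a a_ge0 aE => [|n IHn] b' a a_ge0 aE.
  by apply: subsets_le_mono (@subsets_le1 setT) => //; have := a_ge0 0%N; lra.
have IH := IHn (fun i => b' i.+1) (fun i => a i.+1)
  (fun i => a_ge0 i.+1) (fun i => aE i.+1).
have le_even := subsets_le_dilate_shift (CH _) (isT : (0 : int) < 2) H0 IH.
(* Digit 1 admits all of 2H + 1, at cost 1/2; digit 0 leaves only even elements. *)
have := aE 0%N; case b0 : (b' 0%N) => /= a0E.
  have le_odd := subsets_le_dilate_shift (@subset_refl _ H)
    (isT : (0 : int) < 2) H1 (@subsets_le1 H).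
  apply: subsets_le_mono (subsets_leU le_odd le_even).
    move=> x; case=> [y _ Hy|y Cy]; first by left; exists y.
    by right; exists y => //; rewrite addr0.
  by rewrite exprS; lra.
apply: subsets_le_mono le_even.
  by move=> x; case=> [y|y Cy]; [rewrite b0|exists y => //; rewrite addr0].
by rewrite exprS; lra.
Qed.

End UpperBounds.

(** * The thin basis *)

Lemma exists_thin_basis : exists B : set int,
  [/\ B `<=` H, B 0, B 1, double_set B = H &
    forall (R : realType) (mus : set int -> R),
      upper_quasi_density H mus -> subsets_le mus B 0].
Proof.
(* Both summands of [digits01_decomp] lie in [E s], so its double contains every [s * n]. *)
pose E s := digits01 s `|` dilate_shift 2 (digits01 s) 0.
have H0 : H 0 by exact: ambient_nonneg.
have EH s : H s -> E s `<=` H.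
  move=> Hs x [/digits01_sub|[y /digits01_sub Hy <-]]; first exact.
  by rewrite addr0; apply: ambientMn; [|exact: Hy].
have E0 s : E s 0 by left; exact: Digits01_nil.
have EE s (n : nat) : double_set (E s) (s * n%:Z).
  have [a Ea [b Eb ->]] := digits01_decomp s n.
  exists a; first by left.
  by exists (2 * b) => //; right; exists b => //; rewrite addr0.
have E_small s : H s -> forall (R : realType) (mus : set int -> R),
    upper_quasi_density H mus -> subsets_le mus (E s) 0.
  move=> Hs R mus mus_uqd.
  have leE := subsets_le_digits01 mus_uqd Hs.
  have := subsets_leU mus_uqd leE (subsets_le_dilate_shift mus_uqd
    (digits01_sub Hs) (isT : (0 : int) < 2) H0 leE).
  by rewrite mulr0 addr0.
(* The sign [-1] is needed only if [H = ZZ]; otherwise [t = 1] does no harm. *)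
have [t Ht HE] : exists2 t : int, H t & forall x, H x ->
    exists n : nat, x = 1 * n%:Z \/ x = t * n%:Z.
  case: H_ZN => HE.
    exists (-1); first by rewrite HE.
    by move=> x _; exists `|x|%N; lia.
  exists 1; first exact: ambient_nonneg.
  by move=> x; rewrite HE /NN /= => x_ge0; exists `|x|%N; lia.
have H1 : H 1 by exact: ambient_nonneg.
have BH : E 1 `|` E t `<=` H by move=> x []; exact: EH.
exists (E 1 `|` E t); split=> //.
- by left.
- by left; left; exact: (Digits01_1 (Digits01_nil 1)).
- apply/seteqP; split=> [x [a /BH Ha [b /BH Hb <-]]|x /HE [n]].
    exact: ambientD.
  case=> ->.
    by have [a Ea [b Eb <-]] := EE 1 n; exists a; [left|exists b; [left|]].
  by have [a Ea [b Eb <-]] := EE t n; exists a; [right|exists b; [right|]].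
- move=> R mus mus_uqd; rewrite -[0]addr0.
  by apply: (subsets_leU mus_uqd); exact: E_small.
Qed.

End Ambient.

(** * Binary digits and the final set *)

Lemma exists_binary_digits (R : realType) (alpha : R) :
  0 <= alpha -> alpha <= 1 -> exists b : nat -> bool, exists a : nat -> R,
    [/\ a 0%N = alpha, forall n, 0 <= a n <= 1 &
      forall n, 2 * a n = (b n)%:R + a n.+1].
Proof.
move=> alpha_ge0 alpha_le1.
(* Greedy digits: the map x -> 2x - [dig x] preserves [0,1] and fixes 1, so [alpha = 1] gets all
   digits 1. *)
pose dig (x : R) := 1 <= 2 * x.
pose a n := iter n (fun x : R => 2 * x - (dig x)%:R) alpha.
exists (fun n => dig (a n)), a; split=> // n; last by rewrite [a n.+1]/=; ring.
elim: n => [|n]; first by rewrite /a /= alpha_ge0.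
rewrite [a n.+1]/= -/(a n) /dig; case: (leP 1 (2 * a n)) => /=; lra.
Qed.

Theorem theorem3p3 (R : realType) (H : set int) (H_ZN : H = ZZ \/ H = NN)
    (alpha : R) (alpha_ge0 : 0 <= alpha) (alpha_le1 : alpha <= 1) :
  exists A : set int,
    [/\ A `<=` H, A 0, set_gcd A 1, double_set A = H &
      forall (dom : set (set int)) (mu : set int -> R),
        quasi_density H dom mu -> dom A /\ mu A = alpha].
Proof.
have [B [BH B0 B1 BB B_small]] := exists_thin_basis H_ZN.
have [b [a [a0 a01 aE]]] := exists_binary_digits alpha_ge0 alpha_le1.
have CH := @odd_part_class_sub H H_ZN b.
set C := odd_part_class H b in CH.
have AH : B `|` C `<=` H by move=> x [/BH|/CH].
exists (B `|` C); split=> //.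
- by left.
- split=> [x _|e dvd_e]; first by rewrite dvd1z.
  by have := dvd_e 1 (or_introl B1); rewrite dvdzE.
- apply/seteqP; split=> [x [y /AH Hy [z /AH Hz <-]]|x].
    exact: ambientD.
  by rewrite -{1}BB => -[y By [z Bz <-]]; exists y; [left|exists z; [left|]].
move=> dom mu [mus mus_uqd [domE muE]].
have leC : subsets_le H mus C alpha.
  rewrite -a0; apply: subsets_le_odd_part_class => // n.
  by case/andP: (a01 n).
have leC' : subsets_le H mus (odd_part_class H (fun i => ~~ b i)) (1 - alpha).
  rewrite -a0.
  (* Negating every digit turns each tail [a n] into [1 - a n]. *)
  apply: (@subsets_le_odd_part_class _ _ _ _ mus_uqd _ (fun n => 1 - a n)) => //.
    by move=> n; have := a01 n; lra.
  by move=> n; have := aE n; case: (b n) => /=; lra.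
have leA : mus (B `|` C) <= alpha.
  have := subsets_leU mus_uqd (B_small _ _ mus_uqd) leC.
  by rewrite add0r; apply.
have leA' : mus (H `\` (B `|` C)) <= 1 - alpha.
  apply: leC' => [x [//]|x [Hx nABx]].
  have x0 : x != 0 by apply: contra_notN nABx => /eqP ->; left.
  by have [Cx|//] := odd_part_class_or_negb H_ZN b Hx x0; case: nABx; right.
(* The two upper bounds add up to 1, so this forces equality in both, giving membership in the
   domain and the value [alpha]. *)
have ge1 : 1 <= mus (B `|` C) + mus (H `\` (B `|` C)).
  have := uqd_subadditive mus_uqd AH (@subDsetl _ H (B `|` C)).
  by rewrite (setDUK AH) (uqd_total mus_uqd).
have domA : dom (B `|` C) by rewrite domE; split=> //; rewrite /conjugate; lra.
by split=> //; rewrite muE //; lra.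
Qed.
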